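(* There exists a universal constant $L>0$ such that the following holds. Assume that the covariates $X_i$ are independent and have unit variance. For any integers $1\le k\le p$ and any radius $r>0$, $$\inf_{\widehat\theta}\ \sup_{\theta\in\Theta[k,p](r)}\mathbb{E}_\theta\big[l(\widehat\theta,\theta)\big]\ \ge\ Lk\Big[r^2\wedge\sigma^2\frac{1+\log\left(\frac pk\right)}{n}\Big],$$ where the infimum is over all estimators $\widehat\theta$ of $\theta$ based on the $n$ observations.
   Context: Model: $Y=X\theta+\epsilon$, where $\theta\in\mathbb{R}^p$, the row vector $X=(X_i)_{1\le i\le p}$ is a zero mean Gaussian vector with covariance matrix $\Sigma$, and $\epsilon$ is a zero mean Gaussian variable with variance $\sigma^2>0$, independent of $X$. One observes $n$ i.i.d. replications of $(Y,X)$; $\mathbb{E}_\theta$ is the corresponding expectation. The loss is $l(\theta_1,\theta_2):=\mathbb{E}[(X\theta_1-X\theta_2)^2]$. $\Theta[k,p]$ is the set of vectors of $\mathbb{R}^p$ with at most $k$ non-zero coordinates, and $\Theta[k,p](r)$ is the subset of those $\theta\in\Theta[k,p]$ with $|\theta_i|\le r$ for all $i$. $\wedge$ denotes the minimum. *)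

(* Defs.v *)
From HB Require Import structures.
From mathcomp Require Import all_boot all_order all_algebra.
From mathcomp Require Import all_classical all_reals all_analysis.

Set Implicit Arguments.
Unset Strict Implicit.
Unset Printing Implicit Defensive.

Import Order.TTheory GRing.Theory Num.Theory.
Import numFieldNormedType.Exports.

Local Open Scope classical_set_scope.
Local Open Scope ring_scope.

(* Vectors of R^p are p-tuples, which carry the product sigma-algebra. *)

Definition has_law d d' (T : measurableType d) (E : measurableType d')
    (R : realType) (P : probability T R) (Z : T -> E) (mu : set E -> \bar R) :=
  forall A : set E, measurable A -> P (Z @^-1` A) = mu A.

Definition independent d d1 d2 (T : measurableType d)
    (E1 : measurableType d1) (E2 : measurableType d2) (R : realType)
    (P : probability T R) (Z1 : T -> E1) (Z2 : T -> E2) :=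
  forall (A1 : set E1) (A2 : set E2), measurable A1 -> measurable A2 ->
    P (Z1 @^-1` A1 `&` Z2 @^-1` A2) = (P (Z1 @^-1` A1) * P (Z2 @^-1` A2))%E.

Definition mutually_independent d d' (T : measurableType d)
    (E : measurableType d') (R : realType) (P : probability T R)
    (I : finType) (Z : I -> T -> E) :=
  forall (J : {set I}) (A : I -> set E), (forall i, measurable (A i)) ->
    P (\bigcap_(i in [set` J]) (Z i @^-1` A i)) =
    (\prod_(i in J) P (Z i @^-1` A i))%E.

(* The normal law with mean m and standard deviation s.  The library's
   normal_prob is only meaningful for s != 0; here s = 0 gives a point mass. *)
Definition gaussian (R : realType) (m s : R) (A : set R) : \bar R :=
  if s == 0 then \d_m A else normal_prob m s A.

Definition dot (R : realType) (p : nat) (x theta : p.-tuple R) : R :=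
  \sum_(i < p) tnth x i * tnth theta i.

Definition covariate d (T : measurableType d) (R : realType) (p : nat)
    (X : T -> p.-tuple R) (i : 'I_p) : T -> R := fun w => tnth (X w) i.

(* Gaussian vectors are those all of whose linear combinations are (possibly
   degenerate) normal variables. *)
Definition centered_gaussian_vector d (T : measurableType d) (R : realType)
    (P : probability T R) (p : nat) (X : {RV P >-> p.-tuple R})
    (Sigma : 'M[R]_p) :=
  [/\ forall u : p.-tuple R, exists m s : R,
        0 <= s /\ has_law P (fun w => dot (X w) u) (gaussian m s),
      forall i, ('E_P[covariate X i] = 0)%E
    & forall i j, covariance P (covariate X i) (covariate X j) = (Sigma i j)%:E].

Definition loss d (T : measurableType d) (R : realType) (P : probability T R)
    (p : nat) (X : {RV P >-> p.-tuple R}) (theta1 theta2 : p.-tuple R)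
    : \bar R :=
  'E_P[fun w => (dot (X w) theta1 - dot (X w) theta2) ^+ 2].

Definition response d (T : measurableType d) (R : realType)
    (P : probability T R) (p : nat) (X : {RV P >-> p.-tuple R})
    (eps : {RV P >-> R}) (theta : p.-tuple R) : T -> R :=
  fun w => dot (X w) theta + eps w.

(* The observations are functions on a space S carrying one probability
   Q theta for each parameter theta; under Q theta they are i.i.d. copies of
   (Y, X) with Y = X theta + eps. *)
Definition iid_replications d d' (T : measurableType d) (S : measurableType d')
    (R : realType) (P : probability T R) (p n : nat)
    (X : {RV P >-> p.-tuple R}) (eps : {RV P >-> R})
    (Q : p.-tuple R -> probability S R)
    (obs : 'I_n -> {mfun S >-> (R * p.-tuple R)%type}) :=
  forall theta : p.-tuple R,
    (forall a, has_law (Q theta) (obs a)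
       (pushforward P (fun w => (response X eps theta w, X w)))) /\
    mutually_independent (Q theta) (fun a => obs a : S -> _).

Definition sample d' (S : measurableType d') (R : realType) (p n : nat)
    (obs : 'I_n -> {mfun S >-> (R * p.-tuple R)%type}) (s : S)
    : n.-tuple (R * p.-tuple R)%type :=
  [tuple obs a s | a < n].

Definition sparse (R : realType) (k p : nat) : set (p.-tuple R) :=
  [set theta | (#|[pred i : 'I_p | tnth theta i != 0%R]| <= k)%N].

Definition sparse_box (R : realType) (k p : nat) (r : R) : set (p.-tuple R) :=
  [set theta | sparse k theta /\ forall i, `|tnth theta i| <= r].

Definition risk d d' (T : measurableType d) (S : measurableType d')
    (R : realType) (P : probability T R) (p n : nat)
    (X : {RV P >-> p.-tuple R}) (Q : p.-tuple R -> probability S R)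
    (obs : 'I_n -> {mfun S >-> (R * p.-tuple R)%type})
    (est : {mfun n.-tuple (R * p.-tuple R)%type >-> p.-tuple R})
    (theta : p.-tuple R) : \bar R :=
  (\int[Q theta]_s loss X (est (sample obs s)) theta)%E.

Definition minimax_risk d d' (T : measurableType d) (S : measurableType d')
    (R : realType) (P : probability T R) (p n : nat)
    (X : {RV P >-> p.-tuple R}) (Q : p.-tuple R -> probability S R)
    (obs : 'I_n -> {mfun S >-> (R * p.-tuple R)%type})
    (Theta : set (p.-tuple R)) : \bar R :=
  ereal_inf (range (fun
      est : {mfun n.-tuple (R * p.-tuple R)%type >-> p.-tuple R} =>
    ereal_sup [set risk X Q obs est theta | theta in Theta])).

(* Main.v *)
(* The loss is the squared Euclidean distance, so it splits over coordinates.
   Compare theta_A = rho 1_A with theta_{A u {i}} for |A| = j and i not in A,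
   giving the weight M = (p - j) / (j + 1) to the first one: for an estimator t
   of the i-th coordinate and the likelihood ratio G of the two samples,

     M E_A [t^2] + E_{A u {i}} [(t - rho)^2]
       = E_{A u {i}} [M t^2 G + (t - rho)^2]
       >= c rho^2 E_{A u {i}} [1 + (ln G - G) / K],    K = 4 + ln (p / (j + 1)),

   where c is universal because M exp(-K) is bounded below.  Since E G = 1 and
   - E ln G = n rho^2 / (2 sigma^2) <= (1 + ln (p / (j + 1))) / 2, the right-hand
   side is at least c rho^2 / 2.  Averaging over all pairs (A, i) multiplies this
   by the sparsity j + 1.  The weight M, rather than 1, is what produces the
   factor 1 + ln (p / k). *)

Require Import Defs.
From HB Require Import structures.
From mathcomp Require Import all_boot all_order all_algebra.
From mathcomp Require Import all_classical all_reals all_analysis.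
From mathcomp Require Import measurable_realfun.
From mathcomp Require Import zify ring lra.

Set Implicit Arguments.
Unset Strict Implicit.
Unset Printing Implicit Defensive.

Import Order.TTheory GRing.Theory Num.Theory.
Import numFieldNormedType.Exports.

Local Open Scope classical_set_scope.
Local Open Scope ring_scope.

(** * Densities, and translations of the Lebesgue and normal measures *)

(** [g] agrees [mu]-almost everywhere with the Radon-Nikodym derivative of [nu], because both have
    the same integral over every measurable set. *)
Lemma ge0_integral_density d (T : measurableType d) (R : realType)
    (mu : {sigma_finite_measure set T -> \bar R})
    (nu : {finite_measure set T -> \bar R}) (g : T -> R) :
  measurable_fun setT g -> (forall x, 0 <= g x) ->
  (forall A, measurable A -> nu A = (\int[mu]_(x in A) (g x)%:E)%E) ->
  forall f : T -> \bar R, measurable_fun setT f -> (forall x, (0 <= f x)%E) ->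
  (\int[nu]_x f x = \int[mu]_x (f x * (g x)%:E))%E.
Proof.
move=> mg g0 nuE f mf f0.
have mgE D : measurable_fun D (EFin \o g).
  by apply: measurable_funTS; exact/measurable_EFinP.
have numu : nu `<< mu.
  apply/null_content_dominatesP => A mA muA0; rewrite nuE//.
  by apply: null_set_integral => //; exact: mgE.
rewrite -(Radon_Nikodym_SigmaFinite.change_of_variables numu f0 measurableT mf).
have mRN := measurable_int _ (Radon_Nikodym_SigmaFinite.f_integrable numu).
apply: ae_eq_integral => //.
- exact: emeasurable_funM.
- by apply: emeasurable_funM => //; exact: mgE.
apply: ae_eqe_mul2l; apply: integral_ae_eq => //.
- exact: Radon_Nikodym_SigmaFinite.f_integrable.
- by move=> E _ mE; rewrite -Radon_Nikodym_SigmaFinite.f_integral// nuE.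
Qed.

(** Lebesgue measure is determined by its values on half-open intervals, whose length a translation
    preserves. *)
Lemma lebesgue_measureD (R : realType) (a : R) (A : set (measurableTypeR R)) :
  measurable A ->
  pushforward lebesgue_measure (fun x : measurableTypeR R => x + a) A =
  lebesgue_measure A.
Proof.
move=> mA.
pose D0 := fun x : measurableTypeR R => (x + a : measurableTypeR R).
have mD0 : measurable_fun setT D0 by exact: measurable_funD.
pose D : {mfun measurableTypeR R >-> measurableTypeR R} :=
  HB.pack D0 (isMeasurableFun.Build _ _ _ _ D0 mD0).
apply/esym.
apply: (lebesgue_measure_unique (mu := pushforward lebesgue_measure D)) => //.
move=> _ [[u v]] _ <-.
have DE : D0 @^-1` `]u, v] = `]u - a, v - a]%classic.
  by apply/seteqP; split => x /=; rewrite !in_itv/= ltrBlDr lerBrDr.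
rewrite -[RHS]/(lebesgue_measure (D0 @^-1` `]u, v])) DE.
rewrite !lebesgue_measure_itv/= !lte_fin ltrD2r.
by case: ifP => // _; rewrite -!EFinD; congr EFin; ring.
Qed.

Lemma ge0_lebesgue_integralD (R : realType) (a : R) (f : R -> \bar R) :
  measurable_fun setT f -> (forall x, (0 <= f x)%E) ->
  (\int[lebesgue_measure]_x f (x + a)%R = \int[lebesgue_measure]_x f x)%E.
Proof.
move=> mf f0.
pose D := fun x : measurableTypeR R => (x + a : measurableTypeR R).
have mD : measurable_fun setT D by exact: measurable_funD.
rewrite -[LHS](ge0_integral_pushforward mD _ (D := setT) (f := f))//.
by apply: eq_measure_integral => A mA _; rewrite -[RHS](lebesgue_measureD a).
Qed.

Lemma ge0_normal_integral (R : realType) (s : R) (f : R -> \bar R) :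
  measurable_fun setT f -> (forall x, (0 <= f x)%E) ->
  (\int[normal_prob 0 s]_x f x =
   \int[lebesgue_measure]_x (f x * (normal_pdf 0 s x)%:E))%E.
Proof.
move=> mf f0; apply: (ge0_integral_density
  (mu := [the sigma_finite_measure _ _ of @lebesgue_measure R])
  (nu := [the probability _ _ of @normal_prob R 0 s])) => //.
- exact: measurable_normal_pdf.
- by move=> x; exact: normal_pdf_ge0.
Qed.

(** After translating the Lebesgue integral by [a], the exponential appears as the ratio of the
    normal densities at [x + a] and at [x]. *)
Lemma ge0_normal_integral_shift (R : realType) (s a : R) (f : R -> \bar R) :
  s != 0 -> measurable_fun setT f -> (forall x, (0 <= f x)%E) ->
  (\int[normal_prob 0 s]_x f x = \int[normal_prob 0 s]_x
    (f (x + a)%R * (expR (- (2 * x * a + a ^+ 2) / (2 * s ^+ 2)))%:E))%E.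
Proof.
move=> s0 mf f0.
have mfa : measurable_fun setT (fun x : R => f (x + a)).
  by apply: measurableT_comp => //; exact: measurable_funD.
have me : measurable_fun setT
    (fun x : R => expR (- (2 * x * a + a ^+ 2) / (2 * s ^+ 2))).
  apply: measurableT_comp => //; apply: measurable_funM => //.
  apply: measurableT_comp => //; apply: measurable_funD => //.
  by apply: measurable_funM => //; apply: measurable_funM.
have mfp : measurable_fun setT (fun x => (f x * (normal_pdf 0 s x)%:E)%E).
  apply: emeasurable_funM => //; apply/measurable_EFinP.
  exact: measurable_normal_pdf.
have fp0 x : (0 <= f x * (normal_pdf 0 s x)%:E)%E.
  by rewrite mule_ge0// lee_fin normal_pdf_ge0.
have mfae := emeasurable_funM mfa (iffRL (measurable_EFinP _ _) me).
have fae0 x : (0 <= f (x + a)%R *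
    (expR (- (2 * x * a + a ^+ 2) / (2 * s ^+ 2)))%:E)%E.
  by rewrite mule_ge0// lee_fin expR_ge0.
rewrite ge0_normal_integral// -(ge0_lebesgue_integralD a mfp fp0).
rewrite [RHS](ge0_normal_integral s mfae fae0).
apply: eq_integral => x _; rewrite -muleA -EFinM; congr (_ * _%:E)%E.
rewrite !normal_pdfE// mulrCA /normal_fun -expRD; congr (_ * expR _).
by rewrite -mulr_natl; field.
Qed.

(** * Independence and product laws *)

(** The law of the pair is the product of the marginal laws, so Tonelli applies. This is what allows
    integrating over the noise with the covariates held fixed. *)
Lemma ge0_integral_independent d d1 d2 (T : measurableType d)
    (E1 : measurableType d1) (E2 : measurableType d2) (R : realType)
    (P : probability T R) (Z1 : {RV P >-> E1}) (Z2 : {RV P >-> E2})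
    (f : E1 * E2 -> \bar R) :
  independent P Z1 Z2 -> measurable_fun setT f -> (forall z, (0 <= f z)%E) ->
  (\int[P]_w f (Z1 w, Z2 w) = \int[P]_w \int[P]_v f (Z1 w, Z2 v))%E.
Proof.
move=> indep mf f0.
have mZ : measurable_fun setT (fun w => (Z1 w, Z2 w)).
  by apply/measurable_fun_pairP; split.
pose Z : {mfun T >-> (E1 * E2)%type} :=
  HB.pack (fun w => (Z1 w, Z2 w)) (isMeasurableFun.Build _ _ _ _ _ mZ).
rewrite -[LHS](ge0_integral_distribution Z)//.
rewrite (eq_measure_integral
    (distribution P Z1 \x distribution P Z2)%E); last first.
  move=> A mA _; apply/esym; apply: product_measure_unique => // B C mB mC.
rewrite fubini_tonelli1// ge0_integral_distribution//; last 2 first.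
- exact: measurable_fun_fubini_tonelli_F.
- by move=> x; exact: integral_ge0.
apply: eq_integral => w _ /=; rewrite /fubini_F ge0_integral_distribution//.
exact: measurableT_comp.
Qed.

(** Tonelli applied to absolute values makes the product integrable; Fubini under the product law
    then factors its mean. *)
Lemma independent_expectationM d (T : measurableType d) (R : realType)
    (P : probability T R) (U V : {RV P >-> R}) :
  independent P U V -> P.-integrable setT (EFin \o U) ->
  P.-integrable setT (EFin \o V) ->
  P.-integrable setT (EFin \o (U \* V)) /\
  ('E_P[U \* V] = 'E_P[U] * 'E_P[V])%E.
Proof.
move=> indep iU iV.
have mf : measurable_fun setT (fun z : R * R => (z.1 * z.2)%:E).
  by apply/measurable_EFinP; exact: measurable_funM.
have mZ : measurable_fun setT (fun w => (U w, V w)).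
  by apply/measurable_fun_pairP; split.
pose Z : {mfun T >-> (R * R)%type} :=
  HB.pack (fun w => (U w, V w)) (isMeasurableFun.Build _ _ _ _ _ mZ).
have ltyU : (\int[P]_w `|(U w)%:E| < +oo)%E by case/integrableP : iU.
have ltyV : (\int[P]_w `|(V w)%:E| < +oo)%E by case/integrableP : iV.
have prod_lty : (\int[P]_w \int[P]_v `|(U w * V v)%:E| < +oo)%E.
  under eq_integral => w _.
    under eq_integral do rewrite EFinM abseM.
    rewrite ge0_integralZl//; last first.
      by apply: measurableT_comp => //; exact/measurable_EFinP.
    over.
  rewrite ge0_integralZr//; last 2 first.
  - by apply: measurableT_comp => //; exact/measurable_EFinP.
  - exact: integral_ge0.
  by rewrite lte_mul_pinfty ?integral_ge0// ge0_fin_numE// integral_ge0.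
have iUV : P.-integrable setT (EFin \o (U \* V)).
  apply/integrableP; split; first exact: (measurableT_comp mf mZ).
  rewrite (ge0_integral_independent (Z1 := U) (Z2 := V)
    (f := fun z : R * R => `|(z.1 * z.2)%:E|%E))//.
  exact: measurableT_comp.
split=> //; rewrite unlock.
have distZ A : measurable A ->
    distribution P Z A = (distribution P U \x distribution P V)%E A.
  move=> mA; apply/esym; apply: product_measure_unique => // B C mB mC.
have iprod : (distribution P U \x distribution P V)%E.-integrable setT
    (fun z : R * R => (z.1 * z.2)%:E).
  apply/integrableP; split => //.
  rewrite (eq_measure_integral (distribution P Z)); last first.
    by move=> A mA _; exact/esym/distZ.
  rewrite ge0_integral_distribution//; first by case/integrableP : iUV.
  exact: measurableT_comp.
rewrite -[LHS](integral_distribution (X := Z) mf)//.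
rewrite (eq_measure_integral (distribution P U \x distribution P V)%E); last first.
  by move=> A mA _; exact: distZ.
rewrite -integral12_prod_meas1//.
transitivity (\int[distribution P U]_x (x%:E * \int[P]_w (V w)%:E))%E.
  apply: eq_integral => x _; rewrite /fubini_F integral_distribution//; last 2 first.
  - exact: (measurableT_comp mf).
  - exact: (integrableZl measurableT _ iV).
  by rewrite -integralZl.
rewrite integral_distribution//=; last 2 first.
- by apply: emeasurable_funM => //; exact/measurable_EFinP.
- rewrite -(fineK (integrable_fin_num measurableT iV)).
  exact: (integrableZr measurableT _ iU).
by rewrite -(fineK (integrable_fin_num measurableT iV)) integralZr.
Qed.

(** * Moments of the covariates, and the loss *)

Lemma measurable_dot (R : realType) (p : nat) (theta : p.-tuple R) :
  measurable_fun setT (fun x : p.-tuple R => dot x theta).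
Proof.
apply: measurable_sum => i; apply: measurable_funM => //.
exact: measurable_tnth.
Qed.

Section covariates.
Context d (T : measurableType d) (R : realType) (P : probability T R) (p : nat)
  (X : {RV P >-> p.-tuple R}).

Lemma measurable_covariate (i : 'I_p) : measurable_fun setT (covariate X i).
Proof. exact: (measurableT_comp (measurable_tnth i)). Qed.

HB.instance Definition _ i :=
  isMeasurableFun.Build _ _ _ _ (covariate X i) (measurable_covariate i).

Lemma covariate_sqr_integrable i :
  ('E_P[covariate X i] = 0)%E -> ('V_P[covariate X i] = 1)%E ->
  P.-integrable setT (EFin \o (covariate X i \* covariate X i)) /\
  ('E_P[covariate X i \* covariate X i] = 1)%E.
Proof.
move=> EX VX.
have {}VX : ('E_P[covariate X i \* covariate X i] = 1)%E.
  rewrite -VX /variance covariance.unlock EX /=.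
  by congr expectation; apply/funext => w; rewrite !fctE /= subr0.
split=> //; apply/integrableP; split.
  by apply/measurable_EFinP; exact: measurable_funM.
under eq_integral do rewrite /= ger0_norm ?sqr_ge0 -?expr2//.
by move: VX; rewrite unlock => ->; exact: ltry.
Qed.

Lemma covariate_integrable i :
  ('E_P[covariate X i] = 0)%E -> ('V_P[covariate X i] = 1)%E ->
  P.-integrable setT (EFin \o covariate X i).
Proof.
move=> EX VX; have [iX2 _] := covariate_sqr_integrable EX VX.
have i1 : P.-integrable setT (EFin \o cst 1).
  exact: finite_measure_integrable_cst.
(* Domination of |x| by 1 + x^2. *)
apply: (le_integrable measurableT _ _ (integrableD measurableT i1 iX2)) => //.
  exact/measurable_EFinP.
move=> w _ /=; rewrite lee_fin [leRHS]ger0_norm; last first.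
  by rewrite addr_ge0// -expr2 sqr_ge0.
by rewrite ler_norml; apply/andP; split; nra.
Qed.

Lemma covariateM_expectation i j :
  (forall i, ('E_P[covariate X i] = 0)%E) ->
  (forall i, ('V_P[covariate X i] = 1)%E) ->
  mutually_independent P (covariate X) ->
  P.-integrable setT (EFin \o (covariate X i \* covariate X j)) /\
  ('E_P[covariate X i \* covariate X j] = (i == j)%:R%:E)%E.
Proof.
move=> EX VX indep; case: (eqVneq i j) => [<-|ij].
  exact: covariate_sqr_integrable.
have indepij : independent P (covariate X i) (covariate X j).
  move=> A B mA mB.
  (* Only the values of [C] at [i] and [j] enter the intersection over the pair. *)
  pose C (l : 'I_p) : set R := if l == i then A else B.
  have := indep [set i; j]%SET C.
  rewrite big_setU1 ?inE//= big_set1 /C eqxx eq_sym (negbTE ij) => <-.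
    congr (P _); apply/seteqP; split => w /=.
      by move=> [Aw Bw] l /=; rewrite !inE => /orP[/eqP->|/eqP->];
        rewrite ?eqxx// eq_sym (negbTE ij).
    move=> h; split; first by have := h i; rewrite /= !inE eqxx; apply.
    by have := h j; rewrite /= !inE eqxx orbT eq_sym (negbTE ij); apply.
  by move=> l; case: ifP.
have [iXX ->] := independent_expectationM indepij
  (covariate_integrable (EX i) (VX i)) (covariate_integrable (EX j) (VX j)).
by split=> //; rewrite EX mul0e.
Qed.

(** Independent centred covariates of unit variance are orthonormal in L^2, so only the diagonal
    terms survive when the square is expanded. *)
Lemma lossE theta1 theta2 :
  (forall i, ('E_P[covariate X i] = 0)%E) ->
  (forall i, ('V_P[covariate X i] = 1)%E) ->
  mutually_independent P (covariate X) ->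
  loss X theta1 theta2 =
  (\sum_(i < p) (tnth theta1 i - tnth theta2 i) ^+ 2)%:E.
Proof.
move=> EX VX indep.
pose D i := tnth theta1 i - tnth theta2 i.
rewrite /loss unlock.
transitivity (\int[P]_w \sum_(i < p) \sum_(j < p)
    ((D i * D j)%:E * (covariate X i w * covariate X j w)%:E))%E.
  apply: eq_integral => w _; rewrite /dot -sumrB expr2 mulr_suml -sumEFin.
  apply: eq_bigr => i _; rewrite mulr_sumr -sumEFin; apply: eq_bigr => j _.
  by rewrite -EFinM /D /covariate; congr EFin; ring.
have iXX i j := (covariateM_expectation i j EX VX indep).1.
have EXX i j := (covariateM_expectation i j EX VX indep).2.
rewrite integral_sum//; last first.
  move=> i; apply: integrable_sum => // j _; apply: integrableZl => //.
  exact: iXX.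
rewrite -sumEFin; apply: eq_bigr => i _; rewrite integral_sum//; last first.
  by move=> j; apply: integrableZl => //; exact: iXX.
rewrite (bigD1 i)//= big1 ?adde0 => [|j ji].
  rewrite integralZl//; last exact: iXX.
  by have := EXX i i; rewrite unlock eqxx /= => ->; rewrite mule1.
rewrite integralZl//; last exact: iXX.
by have := EXX i j; rewrite unlock eq_sym (negbTE ji) /= => ->; rewrite mule0.
Qed.

End covariates.

(** * Shift formula and integrability for Gaussian noise *)

Section gaussian_noise.
Context d (T : measurableType d) (R : realType) (P : probability T R)
  (eps : {RV P >-> R}) (s : R).

Lemma ge0_integral_gaussian (f : R -> \bar R) : s != 0 ->
  has_law P eps (gaussian 0 s) ->
  measurable_fun setT f -> (forall x, (0 <= f x)%E) ->
  (\int[P]_w f (eps w) = \int[normal_prob 0 s]_x f x)%E.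
Proof.
move=> s0 law mf f0.
pose eps' : T -> measurableTypeR R := eps.
have meps' : measurable_fun setT eps' by exact: (@measurable_funPT _ _ _ _ eps).
rewrite -[LHS](ge0_integral_pushforward meps' P (D := setT) (f := f))//.
apply: eq_measure_integral => A mA _.
by have := law A mA; rewrite /gaussian (negbTE s0) => lawA; exact: lawA.
Qed.

Lemma ge0_gaussian_shift (a : R) (f : R -> \bar R) : s != 0 ->
  has_law P eps (gaussian 0 s) ->
  measurable_fun setT f -> (forall x, (0 <= f x)%E) ->
  (\int[P]_w f (eps w) = \int[P]_w
    (f (eps w + a)%R *
     (expR (- (2 * eps w * a + a ^+ 2) / (2 * s ^+ 2)))%:E))%E.
Proof.
move=> s0 law mf f0.
rewrite ge0_integral_gaussian// (ge0_normal_integral_shift a)//.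
rewrite -ge0_integral_gaussian//.
- apply: emeasurable_funM.
    by apply: measurableT_comp => //; exact: measurable_funD.
  apply/measurable_EFinP; apply: measurableT_comp => //.
  apply: measurable_funM => //; apply: measurableT_comp => //.
  apply: measurable_funD => //.
  by apply: measurable_funM => //; exact: measurable_funM.
- by move=> x; rewrite mule_ge0// lee_fin expR_ge0.
Qed.

(* Shifting the constant function 1 by [+/- s^2] evaluates the exponential
   moments of order [-/+ 1], which dominate the absolute value. *)
Lemma gaussian_integrable : s != 0 -> has_law P eps (gaussian 0 s) ->
  P.-integrable setT (EFin \o eps).
Proof.
move=> s0 law.
pose h a w := expR (- (2 * eps w * a + a ^+ 2) / (2 * s ^+ 2)).
have mh a : measurable_fun setT (h a).
  apply: measurableT_comp => //; apply: measurable_funM => //.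
  apply: measurableT_comp => //; apply: measurable_funD => //.
  by apply: measurable_funM => //; exact: measurable_funM.
have ih a : P.-integrable setT (EFin \o h a).
  apply/integrableP; split; first exact/measurable_EFinP.
  under eq_integral do rewrite /= ger0_norm ?expR_ge0//.
  have := ge0_gaussian_shift a (f := cst 1%E) s0 law (measurable_cst _)
    (fun=> lee01).
  rewrite integral_cst//= probability_setT mule1.
  under eq_integral do rewrite mul1e.
  by move=> <-; exact: ltry.
(* The two functions are exp(- eps - s^2/2) and exp(eps - s^2/2); the factor exp(s^2/2) used next
   removes the constant from both exponents. *)
have iD := integrableD measurableT (ih (s ^+ 2)) (ih (- s ^+ 2)).
apply: (le_integrable measurableT _ _
  (integrableZl measurableT (expR (s ^+ 2 / 2)) iD)) => //.
  exact/measurable_EFinP.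
move=> w _; rewrite /= /h lee_fin.
rewrite [leRHS]ger0_norm ?mulr_ge0 ?addr_ge0 ?expR_ge0//.
rewrite mulrDr -!expRD.
rewrite (_ : s ^+ 2 / 2 + _ = - eps w); last by field.
rewrite (_ : s ^+ 2 / 2 + _ = eps w); last by field.
have := expR_ge1Dx (eps w); have := expR_ge1Dx (- eps w).
have := expR_ge0 (eps w); have := expR_ge0 (- eps w).
by rewrite ler_norml => *; apply/andP; split; lra.
Qed.

End gaussian_noise.

(** * Likelihood ratio of a single observation *)

(* Density of the law of (Y, X) under theta0 with respect to the one under
   theta1. *)
Definition likelihood_ratio (R : realType) (p : nat) (s : R)
    (theta0 theta1 : p.-tuple R) (z : R * p.-tuple R) : R :=
  let a := dot z.2 theta1 - dot z.2 theta0 in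
  expR (- (2 * (z.1 - dot z.2 theta1) * a + a ^+ 2) / (2 * s ^+ 2)).

Lemma measurable_likelihood_ratio (R : realType) (p : nat) (s : R)
    (theta0 theta1 : p.-tuple R) :
  measurable_fun setT (likelihood_ratio s theta0 theta1).
Proof.
have mdot theta : measurable_fun setT (fun z : R * p.-tuple R => dot z.2 theta).
  exact: (measurableT_comp (measurable_dot theta) measurable_snd).
have ma : measurable_fun setT
    (fun z : R * p.-tuple R => dot z.2 theta1 - dot z.2 theta0).
  exact: measurable_funB.
apply: measurableT_comp => //; apply: measurable_funM => //.
apply: measurableT_comp => //; apply: measurable_funD => //.
  by apply: measurable_funM => //; apply: measurable_funM => //;
    exact: measurable_funB.
exact: measurable_funX.
Qed.

Section single_observation.
Context d (T : measurableType d) (R : realType) (P : probability T R) (p : nat)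
  (X : {RV P >-> p.-tuple R}) (eps : {RV P >-> R}).

Lemma measurable_response theta : measurable_fun setT (response X eps theta).
Proof.
apply: measurable_funD => //.
exact: (measurableT_comp (measurable_dot theta)).
Qed.

Definition observation theta w := (response X eps theta w, X w).

Lemma measurable_observation theta : measurable_fun setT (observation theta).
Proof.
by apply/measurable_fun_pairP; split => //; exact: measurable_response.
Qed.

HB.instance Definition _ theta := isMeasurableFun.Build _ _ _ _
  (observation theta) (measurable_observation theta).

Context (s : R) (s0 : s != 0) (law : has_law P eps (gaussian 0 s))
  (indep : independent P X eps).

(** For fixed [X], the responses under the two parameters differ by a translation by
    [a = dot X theta1 - dot X theta0], so the Gaussian shift formula applies to the noise alone. *)
Lemma observation_density theta0 theta1 (f : R * p.-tuple R -> \bar R) :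
  measurable_fun setT f -> (forall z, (0 <= f z)%E) ->
  (\int[P]_w f (observation theta0 w) =
   \int[P]_w (f (observation theta1 w) *
     (likelihood_ratio s theta0 theta1 (observation theta1 w))%:E))%E.
Proof.
move=> mf f0.
have mg theta : measurable_fun setT
    (fun z : p.-tuple R * R => (dot z.1 theta + z.2, z.1)).
  apply/measurable_fun_pairP; split => /=; last exact: measurable_fst.
  apply: (measurable_funD (f := fun z : p.-tuple R * R => dot z.1 theta)) => //.
  exact: (measurableT_comp (measurable_dot theta) measurable_fst).
pose F z := (f z * (likelihood_ratio s theta0 theta1 z)%:E)%E.
have mF : measurable_fun setT F.
  apply: emeasurable_funM => //; apply/measurable_EFinP.
  exact: measurable_likelihood_ratio.
have F0 z : (0 <= F z)%E by rewrite mule_ge0// lee_fin expR_ge0.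
have e0 := ge0_integral_independent indep
  (f := fun z => f (dot z.1 theta0 + z.2, z.1))
  (measurableT_comp mf (mg theta0)) (fun=> f0 _).
have e1 := ge0_integral_independent indep
  (f := fun z => F (dot z.1 theta1 + z.2, z.1))
  (measurableT_comp mF (mg theta1)) (fun=> F0 _).
rewrite [LHS]e0 [RHS]e1.
apply: eq_integral => w _ /=.
set a := dot (X w) theta1 - dot (X w) theta0.
have mfw : measurable_fun setT (fun e => f (dot (X w) theta0 + e, X w)).
  apply: (measurableT_comp mf); apply/measurable_fun_pairP.
  by split; [exact: measurable_funD | exact: measurable_cst].
apply: (etrans (ge0_gaussian_shift a s0 law mfw (fun=> f0 _))).
apply: eq_integral => v _; rewrite /F /likelihood_ratio /=.
congr (f (_, _) * (expR (- (2 * _ * _ + _) / _))%:E)%E.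
- by rewrite /a; ring.
- by ring.
Qed.

Lemma ln_likelihood_ratioE theta0 theta1 i rho w :
  (forall x : p.-tuple R, dot x theta1 - dot x theta0 = rho * tnth x i) ->
  ln (likelihood_ratio s theta0 theta1 (observation theta1 w)) =
  - rho / s ^+ 2 * (covariate X i w * eps w)
  - rho ^+ 2 / (2 * s ^+ 2) * (covariate X i w * covariate X i w).
Proof.
by move=> h; rewrite expRK /= h /response /covariate; field.
Qed.

(** The logarithm is a combination of [X_i eps], centred by independence, and [X_i^2], of mean 1.
    The value is minus the Kullback-Leibler divergence of the law under [theta1] from the law under
    [theta0]. *)
Lemma expectation_ln_likelihood_ratio theta0 theta1 i rho :
  ('E_P[covariate X i] = 0)%E -> ('V_P[covariate X i] = 1)%E ->
  (forall x : p.-tuple R, dot x theta1 - dot x theta0 = rho * tnth x i) ->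
  let L w := ln (likelihood_ratio s theta0 theta1 (observation theta1 w)) in
  P.-integrable setT (EFin \o L) /\
  (\int[P]_w (L w)%:E = (- (rho ^+ 2 / (2 * s ^+ 2)))%:E)%E.
Proof.
move=> EX VX h L.
have [iX2 EX2] := covariate_sqr_integrable EX VX.
have indepi : independent P (covariate X i) eps.
  move=> A B mA mB.
  have := indep (A1 := (fun x : p.-tuple R => tnth x i) @^-1` A) (A2 := B).
  apply => //; rewrite -[X in measurable X]setTI; exact: measurable_tnth.
have [iXe EXe] := independent_expectationM indepi (covariate_integrable EX VX)
  (gaussian_integrable s0 law).
have LE : EFin \o L = (fun w =>
    (- rho / s ^+ 2)%:E * (covariate X i w * eps w)%:E -
    (rho ^+ 2 / (2 * s ^+ 2))%:E * (covariate X i w * covariate X i w)%:E)%E.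
  by apply/funext => w; rewrite /= /L (ln_likelihood_ratioE _ h).
have i1 := integrableZl measurableT (- rho / s ^+ 2) iXe.
have i2 := integrableZl measurableT (rho ^+ 2 / (2 * s ^+ 2)) iX2.
rewrite -/(EFin \o L) LE; split; first exact: integrableB.
rewrite integralB// !integralZl//.
move: EX2 EXe; rewrite EX mul0e unlock /= => -> ->.
by rewrite mule0 mule1 sub0e.
Qed.

End single_observation.

(** * Product laws on tuples and their densities *)

Definition rectangle (E : Type) (n : nat) (A : 'I_n -> set E) : set (n.-tuple E) :=
  [set t | forall i, A i (tnth t i)].

Lemma measurable_rectangle d (E : measurableType d) n (A : 'I_n -> set E) :
  (forall i, measurable (A i)) -> measurable (rectangle A).
Proof.
move=> mA; rewrite (_ : rectangle A =
    \bigcap_(i in [set: 'I_n]) (fun t : n.-tuple E => tnth t i) @^-1` A i).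
  apply: fin_bigcap_measurable => // i _.
  by rewrite -[X in measurable X]setTI; exact: measurable_tnth.
by apply/seteqP; split => t; [move=> h i _; exact: h | move=> h i; exact: h].
Qed.

(** Rectangles are stable under intersection, and they generate the product sigma-algebra: a
    condition on one coordinate is a rectangle whose other sides are full. *)
Lemma rectangle_measure_unique d (E : measurableType d) (R : realType) n
    (nu nu' : probability (n.-tuple E) R) :
  (forall A : 'I_n -> set E, (forall i, measurable (A i)) ->
    nu (rectangle A) = nu' (rectangle A)) ->
  forall B, measurable B -> nu B = nu' B.
Proof.
move=> nuE; pose G : set (set (n.-tuple E)) :=
  [set rectangle A | A in [set A : 'I_n -> set E | forall i, measurable (A i)]].
have GT : G setT.
  by exists (fun=> setT) => [i//|]; apply/seteqP; split.
apply: (measure_unique G (fun=> setT)) => //.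
- apply/seteqP; split; last first.
    apply: smallest_sub; first exact: sigma_algebra_measurable.
    by move=> _ [A mA <-]; exact: measurable_rectangle.
  have mid : measurable_fun setT
      (fun t : g_sigma_algebraType G => (t : n.-tuple E)).
    apply/measurable_fun_tnthP => i _ A mA; rewrite setTI.
    apply: sub_sigma_algebra.
    exists (fun j => if j == i then A else setT); first by move=> j; case: ifP.
    apply/seteqP; split => t /=; first by move/(_ i); rewrite eqxx.
    by move=> Ai j; case: eqP => // ->.
  by move=> A mA; have := mid measurableT _ mA; rewrite setTI.
- move=> _ _ [A mA <-] [B mB <-].
  exists (fun i => A i `&` B i); first by move=> i; exact: measurableI.
  apply/seteqP; split => t; first by move=> h; split=> i; have [] := h i.
  by move=> [hA hB] i; split; [exact: hA | exact: hB].
- by apply/seteqP; split => // t _; exists 0%N.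
- by move=> _ [A mA <-]; exact: nuE.
- move=> _; exact: (le_lt_trans (probability_le1 nu measurableT) (ltry 1)).
Qed.

Section product_density.
Context d (E : measurableType d) (R : realType) (mu0 mu1 : probability E R)
  (g : E -> R).

Let consm n (z : E * n.-tuple E) : n.+1.-tuple E := [tuple of z.1 :: z.2].

Let measurable_consm n : measurable_fun setT (@consm n).
Proof. by apply: measurable_cons. Qed.

HB.instance Definition _ n :=
  isMeasurableFun.Build _ _ _ _ (@consm n) (@measurable_consm n).

Let consm_rectangle n (mu : probability E R) (nu : probability (n.-tuple E) R)
    (A : 'I_n.+1 -> set E) : (forall i, measurable (A i)) ->
  nu (rectangle (fun i => A (lift ord0 i))) =
    (\prod_(i < n) mu (A (lift ord0 i)))%E ->
  distribution (mu \x nu)%E (@consm n) (rectangle A) =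
    (\prod_(i < n.+1) mu (A i))%E.
Proof.
move=> mA nuE; rewrite /distribution /pushforward.
rewrite (_ : _ @^-1` _ = A ord0 `*` rectangle (fun i => A (lift ord0 i))).
  rewrite big_ord_recl -nuE; apply: product_measure1E => //.
  exact: measurable_rectangle.
apply/seteqP; split => -[x t] /=.
  move=> h; split; first by have := h ord0; rewrite tnth0.
  by move=> i; have := h (lift ord0 i); rewrite tnthS.
move=> [/= Ax At] i; case: (unliftP ord0 i) => [j ->|->]; last by rewrite tnth0.
by rewrite tnthS; exact: At.
Qed.

(** Induction on [n]: the law on [n.+1]-tuples is the image under cons of the product of one factor
    with the law on [n]-tuples. The values on rectangles are recorded so that these laws can later
    be identified with those of the sample. *)
Lemma product_density n :
  measurable_fun setT g -> (forall x, 0 <= g x) ->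
  (forall f : E -> \bar R, measurable_fun setT f -> (forall x, (0 <= f x)%E) ->
    (\int[mu0]_x f x = \int[mu1]_x (f x * (g x)%:E))%E) ->
  exists nu0 nu1 : probability (n.-tuple E) R,
  [/\ forall A : 'I_n -> set E, (forall i, measurable (A i)) ->
        nu0 (rectangle A) = (\prod_(i < n) mu0 (A i))%E,
      forall A : 'I_n -> set E, (forall i, measurable (A i)) ->
        nu1 (rectangle A) = (\prod_(i < n) mu1 (A i))%E &
      forall f : n.-tuple E -> \bar R,
        measurable_fun setT f -> (forall t, (0 <= f t)%E) ->
        (\int[nu0]_t f t =
         \int[nu1]_t (f t * (\prod_(i < n) g (tnth t i))%:E))%E].
Proof.
move=> mg g0 dens; elim: n => [|n [nu0 [nu1 [nu0E nu1E nudens]]]].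
  have rectT (A : 'I_0 -> set E) : rectangle A = setT.
    by apply/seteqP; split => // t _ [].
  exists \d_[tuple], \d_[tuple]; split => [A _|A _|f mf f0].
  - by rewrite big_ord0 rectT probability_setT.
  - by rewrite big_ord0 rectT probability_setT.
  - by apply: eq_integral => t _; rewrite big_ord0 mule1.
have mprod m : measurable_fun setT
    (fun t : m.-tuple E => (\prod_(i < m) g (tnth t i))%:E).
  apply/measurable_EFinP; apply: measurable_prod => i _.
  exact: (measurableT_comp mg (measurable_tnth i)).
exists (distribution (mu0 \x nu0)%E (@consm n)).
exists (distribution (mu1 \x nu1)%E (@consm n)); split => [A mA|A mA|f mf f0].
- by apply: consm_rectangle => //; exact: nu0E.
- by apply: consm_rectangle => //; exact: nu1E.
pose F t := (f t * (\prod_(i < n.+1) g (tnth t i))%:E)%E.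
have mF : measurable_fun setT F.
  exact: (emeasurable_funM mf (mprod _)).
have F0 t : (0 <= F t)%E by rewrite mule_ge0// lee_fin prodr_ge0.
have mfc : measurable_fun setT (f \o @consm n) by exact: measurableT_comp.
have mFc : measurable_fun setT (F \o @consm n) by exact: measurableT_comp.
rewrite !ge0_integral_distribution// (fubini_tonelli1 _ mfc); last by move=> z; exact: f0.
rewrite (fubini_tonelli1 _ mFc)//; last by move=> z; exact: F0.
(* The density formula changes the law of the head; the induction hypothesis then changes that of
   the tail. *)
rewrite dens; last 2 first.
- by apply: (measurable_fun_fubini_tonelli_F _ mfc) => z; exact: f0.
- by move=> x; apply: integral_ge0 => t _; exact: f0.
apply: eq_integral => x _.
have mfx : measurable_fun setT (fun t => f (consm (x, t))).
  exact: (measurableT_comp mfc (pair1_measurable x)).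
rewrite /fubini_F nudens//; last by move=> t; exact: f0.
transitivity (\int[nu1]_t (f (consm (x, t)) *
    (\prod_(i < n) g (tnth t i))%:E * (g x)%:E))%E.
  rewrite ge0_integralZr//; [exact: (emeasurable_funM mfx (mprod _)) | | by rewrite lee_fin].
  by move=> t _; rewrite mule_ge0 ?f0// lee_fin prodr_ge0.
apply: eq_integral => t _; rewrite /F /= big_ord_recl tnth0.
under [in RHS]eq_bigr do rewrite tnthS.
by rewrite -muleA -EFinM mulrC.
Qed.

End product_density.

(** * The weighted two-point inequality *)

(** If [ln G <= - K], the left-hand side is nonpositive. Otherwise [M * G >= m], the last factor on
    the left is at most 1 since [ln G <= G], and the minimum over [t] of m t^2 + (t - rho)^2 is m
    rho^2 / (1 + m). *)
Lemma two_point_pointwise (R : realType) (t rho M K m G : R) :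
  0 < K -> 0 < m -> m <= M * expR (- K) -> 0 < G ->
  m / (1 + m) * rho ^+ 2 * (1 + K^-1 * ln G - K^-1 * G) <=
  M * (t ^+ 2 * G) + (t - rho) ^+ 2.
Proof.
move=> K0 m0 mM G0.
have m1 : 0 < 1 + m by rewrite addr_gt0.
have M0 : 0 < M by rewrite -(pmulr_lgt0 _ (expR_gt0 (- K))) (lt_le_trans m0).
have c0 : 0 <= m / (1 + m) * rho ^+ 2 by rewrite mulr_ge0 ?sqr_ge0// divr_ge0 ?ltW.
have Ki : 0 < K^-1 by rewrite invr_gt0.
have [GK|KG] := leP (ln G) (- K).
  apply: (@le_trans _ _ 0); last first.
    by apply: addr_ge0; rewrite ?sqr_ge0// pmulr_rge0// pmulr_lge0// sqr_ge0.
  rewrite mulr_ge0_le0//.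
  have : K^-1 * ln G <= -1 by rewrite mulrC ler_pdivrMr// mulN1r.
  have : 0 < K^-1 * G by rewrite mulr_gt0.
  lra.
have mMG : m <= M * G.
  apply: (le_trans mM); rewrite ler_pM2l//.
  by rewrite -[leRHS]lnK ?posrE// ler_expR ltW.
apply: (@le_trans _ _ (m / (1 + m) * rho ^+ 2 * 1)).
  rewrite ler_wpM2l//.
  have : K^-1 * ln G <= K^-1 * G by rewrite ler_pM2l// ltW// ln_sublinear.
  lra.
apply: (@le_trans _ _ (m * t ^+ 2 + (t - rho) ^+ 2)); last first.
  by rewrite lerD2r mulrCA [M * G]mulrC in mMG *; have := sqr_ge0 t; nra.
rewrite mulr1 mulrAC ler_pdivrMr//.
(* This square equals (1 + m) (m t^2 + (t - rho)^2) - m rho^2. *)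
by have := sqr_ge0 ((1 + m) * t - rho); nra.
Qed.

(** The upper function may have infinite integral, as the risk of an arbitrary estimator can; the
    bound is then trivial. *)
Lemma le_integral_ge0 d (T : measurableType d) (R : realType)
    (mu : {measure set T -> \bar R}) (h f : T -> \bar R) :
  mu.-integrable setT h -> measurable_fun setT f -> (forall x, (0 <= f x)%E) ->
  (forall x, (h x <= f x)%E) -> (\int[mu]_x h x <= \int[mu]_x f x)%E.
Proof.
move=> ih mf f0 hf.
have [->|fin] := eqVneq (\int[mu]_x f x)%E +oo%E; first exact: leey.
apply: le_integral => //; apply/integrableP; split => //.
by under eq_integral do rewrite gee0_abs//; rewrite ltey.
Qed.

(* Only the first logarithmic moment of the likelihood ratio G is needed: its
   exponential moments of higher order may be infinite when rho is large
   compared with the noise. *)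
Lemma two_point_bound d (S : measurableType d) (R : realType)
    (Q : probability S R) (t G : S -> R) (rho M K m kappa : R) :
  0 < K -> 0 < m -> m <= M * expR (- K) ->
  measurable_fun setT t -> measurable_fun setT G -> (forall s, 0 < G s) ->
  (\int[Q]_s (G s)%:E = 1)%E ->
  Q.-integrable setT (fun s => (ln (G s))%:E) ->
  (\int[Q]_s (ln (G s))%:E = (- kappa)%:E)%E ->
  ((m / (1 + m) * rho ^+ 2 * (1 - (kappa + 1) / K))%:E <=
   M%:E * \int[Q]_s ((t s ^+ 2)%:E * (G s)%:E) +
   \int[Q]_s ((t s - rho) ^+ 2)%:E)%E.
Proof.
move=> K0 m0 mM mt mG G0 intG ilnG intlnG.
have M0 : 0 < M by rewrite -(pmulr_lgt0 _ (expR_gt0 (- K))) (lt_le_trans m0).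
have mt2 : measurable_fun setT (fun s => (t s ^+ 2)%:E).
  by apply/measurable_EFinP; exact: measurable_funX.
have mt2G : measurable_fun setT (fun s => ((t s ^+ 2)%:E * (G s)%:E)%E).
  by apply: emeasurable_funM => //; exact/measurable_EFinP.
have mtr : measurable_fun setT (fun s => ((t s - rho) ^+ 2)%:E).
  by apply/measurable_EFinP; apply: measurable_funX; exact: measurable_funB.
have t2G0 s : (0 <= (t s ^+ 2)%:E * (G s)%:E)%E.
  by rewrite mule_ge0// lee_fin ?sqr_ge0// ltW.
rewrite -ge0_integralZl//; last by rewrite lee_fin ltW.
rewrite -ge0_integralD//; last 3 first.
- by move=> s _; rewrite mule_ge0// lee_fin ltW.
- exact: emeasurable_funM.
- by move=> s _; rewrite lee_fin sqr_ge0.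
have iG : Q.-integrable setT (EFin \o G).
  apply/integrableP; split; first exact/measurable_EFinP.
  under eq_integral do rewrite gee0_abs ?lee_fin ?ltW//.
  by rewrite intG ltry.
have i1 : Q.-integrable setT (EFin \o cst (1 : R)).
  exact: finite_measure_integrable_cst.
have i2 := integrableZl measurableT K^-1 ilnG.
have i3 := integrableZl measurableT K^-1 iG.
have i12 := integrableD measurableT i1 i2.
have i123 := integrableB measurableT i12 i3.
have ih := integrableZl measurableT (m / (1 + m) * rho ^+ 2) i123.
apply: le_trans (le_integral_ge0 ih _ _ _); last 3 first.
- by apply: emeasurable_funD => //; exact: emeasurable_funM.
- move=> s; apply: adde_ge0; last by rewrite lee_fin sqr_ge0.
  by rewrite mule_ge0// lee_fin ltW.
- move=> s; rewrite -!EFinM -!EFinD lee_fin.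
  exact: two_point_pointwise.
(* The constant, [ln G] and [G] integrate to 1, [- kappa] and 1. *)
rewrite integralZl// integralB// integralD// !integralZl//.
have int1 : (\int[Q]_s (EFin \o cst 1%R) s = 1%:E)%E.
  by rewrite -(expectation_cst Q 1) unlock.
rewrite intlnG intG mule1 int1 -EFinM lee_fin.
apply: ler_wpM2l; last by lra.
by rewrite mulr_ge0 ?sqr_ge0// divr_ge0 ?addr_ge0 ?ltW.
Qed.

(** * From one observation to the whole sample *)

Section sample.
Context d d' (T : measurableType d) (S : measurableType d') (R : realType)
  (P : probability T R) (p n : nat) (X : {RV P >-> p.-tuple R})
  (eps : {RV P >-> R}) (Q : p.-tuple R -> probability S R)
  (obs : 'I_n -> {mfun S >-> (R * p.-tuple R)%type}).

Lemma measurable_sample : measurable_fun setT (sample obs).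
Proof.
apply/measurable_fun_tnthP => a.
rewrite (_ : _ \o _ = obs a); first exact: measurable_funPT.
by apply/funext => w /=; rewrite tnth_mktuple.
Qed.

HB.instance Definition _ :=
  isMeasurableFun.Build _ _ _ _ (sample obs) measurable_sample.

Context (iid : iid_replications X eps Q obs).

Lemma ge0_integral_obs theta a (f : R * p.-tuple R -> \bar R) :
  measurable_fun setT f -> (forall z, (0 <= f z)%E) ->
  (\int[Q theta]_w f (obs a w) = \int[P]_w f (observation X eps theta w))%E.
Proof.
move=> mf f0; have [law _] := iid theta.
rewrite -[LHS](ge0_integral_distribution (obs a) mf f0).
rewrite -[RHS](ge0_integral_distribution (observation X eps theta) mf f0).
by apply: eq_measure_integral => A mA _; exact: law.
Qed.

(** Mutual independence gives the law of the sample the same values as [nu] on rectangles, which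
    determine a probability. *)
Lemma ge0_integral_sample theta (nu : probability (n.-tuple (R * p.-tuple R)) R)
    (f : n.-tuple (R * p.-tuple R) -> \bar R) :
  (forall A : 'I_n -> set (R * p.-tuple R), (forall i, measurable (A i)) ->
    nu (rectangle A) =
    (\prod_(i < n) distribution P (observation X eps theta) (A i))%E) ->
  measurable_fun setT f -> (forall t, (0 <= f t)%E) ->
  (\int[Q theta]_w f (sample obs w) = \int[nu]_t f t)%E.
Proof.
move=> nuE mf f0; have [law indep] := iid theta.
rewrite -[LHS](ge0_integral_distribution (sample obs) mf f0).
apply: eq_measure_integral => B mB _.
apply: rectangle_measure_unique => // A mA; rewrite nuE//.
transitivity (Q theta (\bigcap_(a in [set` [set: 'I_n]%SET]) obs a @^-1` A a)).
  rewrite /distribution /pushforward; congr (Q theta _).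
  apply/seteqP; split => w h a; first by move=> _; have := h a; rewrite tnth_mktuple.
  by rewrite tnth_mktuple; apply: h; rewrite /= inE.
rewrite indep//; apply: eq_big => a; first by rewrite inE.
by move=> _; exact: law.
Qed.

Context (s : R) (s0 : s != 0) (law : has_law P eps (gaussian 0 s))
  (indep : independent P X eps).

(** The single-observation density tensorises, and the resulting product laws are those of the
    sample under the two parameters. *)
Lemma sample_density theta0 theta1 (f : n.-tuple (R * p.-tuple R) -> \bar R) :
  measurable_fun setT f -> (forall t, (0 <= f t)%E) ->
  (\int[Q theta0]_w f (sample obs w) = \int[Q theta1]_w (f (sample obs w) *
     (\prod_(a < n) likelihood_ratio s theta0 theta1 (obs a w))%:E))%E.
Proof.
move=> mf f0.
pose g := likelihood_ratio s theta0 theta1.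
have mg : measurable_fun setT g by exact: measurable_likelihood_ratio.
have g0 z : 0 <= g z by exact: expR_ge0.
have dens f' : measurable_fun setT f' -> (forall z, (0 <= f' z)%E) ->
    (\int[distribution P (observation X eps theta0)]_z f' z =
     \int[distribution P (observation X eps theta1)]_z (f' z * (g z)%:E))%E.
  move=> mf' f'0.
  rewrite !ge0_integral_distribution//.
  - exact: observation_density.
  - by apply: emeasurable_funM => //; exact/measurable_EFinP.
  - by move=> z; rewrite mule_ge0// lee_fin.
have [nu0 [nu1 [nu0E nu1E nudens]]] := product_density n mg g0 dens.
pose F t := (f t * (\prod_(a < n) g (tnth t a))%:E)%E.
have mF : measurable_fun setT F.
  apply: emeasurable_funM => //; apply/measurable_EFinP.
  apply: measurable_prod => a _.
  exact: (measurableT_comp mg (measurable_tnth a)).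
have F0 t : (0 <= F t)%E by rewrite mule_ge0// lee_fin prodr_ge0.
rewrite (ge0_integral_sample nu0E mf f0) (nudens f mf f0).
rewrite -[LHS](ge0_integral_sample nu1E mF F0).
apply: eq_integral => w _; congr (_ * _%:E)%E.
by apply: eq_bigr => a _; rewrite tnth_mktuple.
Qed.

(** Here [G] is the product of the [n] likelihood ratios; its logarithm is a sum, so [kappa] is [n]
    times the divergence of one observation. *)
Lemma two_point_risk theta0 theta1 i rho M K m
    (t : n.-tuple (R * p.-tuple R) -> R) :
  ('E_P[covariate X i] = 0)%E -> ('V_P[covariate X i] = 1)%E ->
  (forall x : p.-tuple R, dot x theta1 - dot x theta0 = rho * tnth x i) ->
  0 < K -> 0 < m -> m <= M * expR (- K) -> measurable_fun setT t ->
  ((m / (1 + m) * rho ^+ 2 *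
      (1 - (n%:R * (rho ^+ 2 / (2 * s ^+ 2)) + 1) / K))%:E <=
   M%:E * \int[Q theta0]_w (t (sample obs w) ^+ 2)%:E +
   \int[Q theta1]_w ((t (sample obs w) - rho) ^+ 2)%:E)%E.
Proof.
move=> EX VX h K0 m0 mM mt.
pose g := likelihood_ratio s theta0 theta1.
have mg : measurable_fun setT g by exact: measurable_likelihood_ratio.
have mgobs a : measurable_fun setT (fun w => g (obs a w)).
  exact: measurableT_comp.
have mts : measurable_fun setT (fun w => t (sample obs w)).
  by apply: measurableT_comp => //; exact: measurable_sample.
rewrite (@sample_density theta0 theta1 (fun z => (t z ^+ 2)%:E)); last 2 first.
- by apply/measurable_EFinP; exact: measurable_funX.
- by move=> z; rewrite lee_fin sqr_ge0.
have [iL EL] := expectation_ln_likelihood_ratio s0 law indep EX VX h.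
have mln : measurable_fun setT (fun z => (ln (g z))%:E).
  by apply/measurable_EFinP; apply: measurableT_comp => //; exact: measurable_ln.
have iLobs a : (Q theta1).-integrable setT (fun w => (ln (g (obs a w)))%:E).
  apply/integrableP; split; first by apply: (measurableT_comp mln).
  rewrite (@ge0_integral_obs theta1 a (fun z => `|(ln (g z))%:E|%E)) //.
    by case/integrableP : iL.
  exact: measurableT_comp.
have ELobs a : (\int[Q theta1]_w (ln (g (obs a w)))%:E =
    (- (rho ^+ 2 / (2 * s ^+ 2)))%:E)%E.
  rewrite -[RHS]EL -[LHS](integral_distribution mln (iLobs a)).
  rewrite -[RHS](integral_distribution mln iL).
  apply: eq_measure_integral => A mA _.
  by have [lawobs _] := iid theta1; exact: lawobs.
have lnE w : ln (\prod_(a < n) g (obs a w)) = \sum_(a < n) ln (g (obs a w)).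
  apply: expR_inj; rewrite lnK ?posrE; last first.
    by apply: prodr_gt0 => *; exact: expR_gt0.
  rewrite expR_sum; apply: eq_bigr => a _; rewrite lnK// posrE.
  exact: expR_gt0.
apply: two_point_bound => //.
- by apply: measurable_prod => a _.
- by move=> w; rewrite prodr_gt0// => a _; exact: expR_gt0.
(* Applied to the constant 1, the density formula says that [G] has mean 1. *)
- have := @sample_density theta0 theta1 (cst 1%E) (measurable_cst _)
    (fun=> lee01).
  under [RHS]eq_integral do rewrite mul1e.
  by move=> <-; rewrite integral_cst//= probability_setT mule1.
- apply: (eq_integrable _ (fun w => \sum_(a < n) (ln (g (obs a w)))%:E)%E) => //.
    by move=> w _; rewrite lnE sumEFin.
  exact: integrable_sum.
- under eq_integral do rewrite lnE -sumEFin.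
  rewrite integral_sum//; under eq_bigr do rewrite ELobs.
  by rewrite sumEFin sumr_const card_ord mulNrn [_%:R * (_ / _)]mulr_natl.
Qed.

End sample.

(** * Averaging over the supports *)

(** For fixed [i], adding [i] and removing [i] are inverse bijections between the sets that avoid
    [i] and those that contain it. *)
Lemma sum_pointed_set (R : realType) (I : finType) (j : nat)
    (H : {set I} -> I -> \bar R) :
  (\sum_(A : {set I} | #|A| == j) \sum_(i | i \notin A) H (i |: A)%SET i =
   \sum_(B : {set I} | #|B| == j.+1) \sum_(i in B) H B i)%E.
Proof.
rewrite (exchange_big_dep xpredT)//= [RHS](exchange_big_dep xpredT)//=.
apply: eq_bigr => i _.
rewrite [RHS](reindex_onto (fun A => i |: A)%SET (fun B => B :\ i)%SET)/=.
  apply: eq_bigl => A; rewrite setU11 andbT cardsU1.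
  (* The reindexing requires that removing [i] from [i |: A] give back [A], which fails exactly when
     [i] is in [A]. *)
  case: (boolP (i \in A)) => iA /=; last by rewrite setU1K// eqxx !andbT -eqSS.
  rewrite andbF; apply/esym/negbTE; rewrite negb_and; apply/orP; right.
  by apply/eqP => /setP/(_ i); rewrite !inE eqxx iA.
by move=> B /andP[_ iB]; rewrite finset.setD1K.
Qed.

(* The weight (p - j) / (j + 1) is the ratio of the number of sets of size
   j + 1 to the number of sets of size j, so both sides of the two-point
   inequality contribute equally to the sum over all pairs (A, i). *)
Lemma sparse_average (R : realType) (p j : nat)
    (F H : {set 'I_p} -> 'I_p -> \bar R) (c : R) (s : \bar R) :
  (j < p)%N -> (0 <= s)%E -> (forall A i, (0 <= F A i)%E) ->
  (forall A : {set 'I_p}, #|A| = j -> (\sum_(i | i \notin A) F A i <= s)%E) ->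
  (forall B : {set 'I_p}, #|B| = j.+1 -> (\sum_(i in B) H B i <= s)%E) ->
  (forall (A : {set 'I_p}) i, i \notin A ->
    (c%:E <= ((p - j)%:R / j.+1%:R)%:E * F A i + H (i |: A)%SET i)%E) ->
  ((j.+1%:R * c / 2)%:E <= s)%E.
Proof.
move=> jp; case: s => [r| |//] r0 F0 FA HB FH; last exact: leey.
pose M : R := (p - j)%:R / j.+1%:R.
have : (\sum_(A : {set 'I_p} | #|A| == j) \sum_(i | i \notin A) c%:E <=
    \sum_(A : {set 'I_p} | #|A| == j) (M * r)%:E +
    \sum_(B : {set 'I_p} | #|B| == j.+1) r%:E)%E.
  apply: (@le_trans _ _ (\sum_(A : {set 'I_p} | #|A| == j)
      \sum_(i | i \notin A) (M%:E * F A i + H (i |: A)%SET i)))%E.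
    by apply: lee_sum => A _; apply: lee_sum => i; exact: FH.
  under eq_bigr do rewrite big_split/=.
  rewrite big_split/= sum_pointed_set; apply: leeD.
    apply: lee_sum => A /eqP jA; rewrite -ge0_sume_distrr// [leRHS]EFinM.
    by apply: lee_wpmul2l (FA A jA); rewrite lee_fin divr_ge0.
  by apply: lee_sum => B /eqP; exact: HB.
have sum_draws m (x : R) :
    (\sum_(A : {set 'I_p} | #|A| == m) x%:E = ('C(p, m)%:R * x)%:E)%E.
  rewrite sumEFin sumr_const mulr_natl; congr (_ *+ _)%:E.
  by rewrite -[in RHS](card_ord p) -card_draws cardsE.
under eq_bigr => A /eqP jA.
  rewrite sumEFin sumr_const (_ : #|_| = (p - j)%N); last first.
    have cA : (j + #|[predC A]| = p)%N by rewrite -jA cardC card_ord.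
    by rewrite -[in RHS]cA addKn; apply: eq_card => i; rewrite !inE.
  over.
rewrite !sum_draws -EFinD !lee_fin -[c *+ _]mulr_natl.
have bin : j.+1%:R * 'C(p, j.+1)%:R = (p - j)%:R * 'C(p, j)%:R :> R.
  by rewrite -!natrM mul_bin_left.
have j0 : 0 < j.+1%:R :> R by rewrite ltr0n.
have C0 : 0 < 'C(p, j.+1)%:R :> R by rewrite ltr0n bin_gt0.
(* The weight [M] turns the number of [j]-sets into the number of [j.+1]-sets. *)
have -> : 'C(p, j)%:R * (M * r) = 'C(p, j.+1)%:R * r.
  rewrite mulrA; congr (_ * r); apply: (mulfI (lt0r_neq0 j0)).
  by rewrite bin /M; field; rewrite lt0r_neq0.
(* What remains is (j + 1) C(p, j + 1) c <= 2 C(p, j + 1) r. *)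
rewrite mulrA [_ * (p - j)%:R]mulrC -bin => h.
rewrite -(ler_pM2l C0); nra.
Qed.

(** * Parameters constant on a support, and their risk *)

Definition set_tuple (R : realType) (p : nat) (rho : R) (A : {set 'I_p}) :
    p.-tuple R :=
  [tuple if i \in A then rho else 0 | i < p].

Lemma dot_set_tupleU1 (R : realType) (p : nat) (rho : R) (A : {set 'I_p}) i
    (x : p.-tuple R) : i \notin A ->
  dot x (set_tuple rho (i |: A)%SET) - dot x (set_tuple rho A) =
  rho * tnth x i.
Proof.
move=> iA; rewrite /dot -sumrB (bigD1 i)//= !tnth_mktuple setU11 (negbTE iA).
rewrite big1 => [|l li]; first by ring.
by rewrite !tnth_mktuple in_setU1 (negbTE li) subrr.
Qed.

Lemma set_tuple_sparse_box (R : realType) (p k : nat) (r rho : R)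
    (A : {set 'I_p}) : (#|A| <= k)%N -> 0 <= rho <= r ->
  sparse_box k r (set_tuple rho A).
Proof.
move=> Ak /andP[rho0 rhor]; split.
  apply: leq_trans Ak; apply/subset_leq_card/fintype.subsetP => i.
  by rewrite !inE tnth_mktuple; case: ifP => // _; rewrite eqxx.
move=> i; rewrite tnth_mktuple; case: ifP => _; first by rewrite ger0_norm.
by rewrite normr0 (le_trans rho0).
Qed.

Lemma riskE d d' (T : measurableType d) (S : measurableType d') (R : realType)
    (P : probability T R) (p n : nat) (X : {RV P >-> p.-tuple R})
    (Q : p.-tuple R -> probability S R)
    (obs : 'I_n -> {mfun S >-> (R * p.-tuple R)%type})
    (est : {mfun n.-tuple (R * p.-tuple R)%type >-> p.-tuple R}) theta :
  (forall i, 'E_P[covariate X i] = 0)%E ->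
  (forall i, 'V_P[covariate X i] = 1)%E ->
  mutually_independent P (covariate X) ->
  (risk X Q obs est theta = \sum_(i < p) \int[Q theta]_w
    ((tnth (est (sample obs w)) i - tnth theta i) ^+ 2)%:E)%E.
Proof.
move=> EX VX indep; rewrite /risk.
under eq_integral do rewrite lossE// -sumEFin.
rewrite ge0_integral_sum// => i; last by move=> w _; rewrite lee_fin sqr_ge0.
apply/measurable_EFinP; apply: measurable_funX; apply: measurable_funB => //.
apply: (measurableT_comp (measurable_tnth i)).
by apply: measurableT_comp => //; exact: measurable_sample.
Qed.

(* j + 1 = min(k, (p + 1) / 2) nonzero coordinates: as many as k up to a factor
   2, while at least half of the coordinates remain free. *)
Lemma sparse_level (k p : nat) : (1 <= k <= p)%N ->
  exists j, [/\ (j < p)%N, (j < k)%N, (k <= 2 * j.+1)%N & (p <= 2 * (p - j))%N].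
Proof.
by move=> kp; exists (minn k.-1 p.-1./2); split; lia.
Qed.

(** * Choice of the constants and conclusion *)

Theorem proposition4p3 (R : realType) :
  exists L : R, 0 < L /\
  forall (d d' : measure_display) (T : measurableType d) (S : measurableType d')
    (P : probability T R) (k p n : nat) (r sigma : R) (Sigma : 'M[R]_p)
    (X : {RV P >-> p.-tuple R}) (eps : {RV P >-> R})
    (Q : p.-tuple R -> probability S R)
    (obs : 'I_n -> {mfun S >-> (R * p.-tuple R)%type}),
  (1 <= k <= p)%N -> (1 <= n)%N -> 0 < r -> 0 < sigma ->
  centered_gaussian_vector X Sigma ->
  has_law P eps (gaussian 0 sigma) ->
  independent P X eps ->
  iid_replications X eps Q obs ->
  mutually_independent P (covariate X) ->
  (forall i, 'V_P[covariate X i] = 1%E) ->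
  ((L * k%:R * Num.min (r ^+ 2)
      (sigma ^+ 2 * ((1 + ln (p%:R / k%:R)) / n%:R)))%:E
    <= minimax_risk X Q obs (sparse_box k r))%E.
Proof.
(* With [K = 4 + ln q], M exp(-K) is exp(-4) M / q, and M / q = (p - j) / p is at least 1/2. *)
pose m : R := expR (- 4) / 2.
have m0 : 0 < m by rewrite divr_gt0 ?expR_gt0.
have m1 : 0 < 1 + m by rewrite addr_gt0.
(* The 8 collects three halves: the information bound, the average over pairs, and
   [k <= 2 * j.+1]. *)
exists (m / (1 + m) / 8); split; first by rewrite !divr_gt0.
move=> d d' T S P k p n r sigma Sigma X eps Q obs kp n0 r0 sigma0 [_ EX _] law
  indep iid indepX VX.
have [j [jp jk kj pj]] := sparse_level kp.
have /andP[k1 kp1] := kp.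
have k0 : 0 < k%:R :> R by rewrite ltr0n.
have p0 : 0 < p%:R :> R by rewrite ltr0n (leq_trans k1).
have j0 : 0 < j.+1%:R :> R by rewrite ltr0n.
have nn0 : 0 < n%:R :> R by rewrite ltr0n.
set mn := Num.min _ _.
pose q : R := p%:R / j.+1%:R.
have q0 : 0 < q by rewrite divr_gt0.
have q1 : 1 <= q by rewrite ler_pdivlMr// mul1r ler_nat.
have pkq : p%:R / k%:R <= q :> R by rewrite ler_pM2l// lef_pV2 ?posrE// ler_nat.
have pk1 : 1 <= p%:R / k%:R :> R by rewrite ler_pdivlMr// mul1r ler_nat.
have lnpk : 0 <= ln (p%:R / k%:R : R) by rewrite ln_ge0.
have lnq : ln (p%:R / k%:R : R) <= ln q by rewrite ler_ln ?posrE ?divr_gt0.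
have mn0 : 0 <= mn.
  by rewrite le_min sqr_ge0/= mulr_ge0 ?sqr_ge0// divr_ge0// addr_ge0.
(* The largest amplitude that stays in the box and keeps n rho^2 / (2 sigma^2) at most (1 + ln (p /
   k)) / 2. *)
pose rho := Num.sqrt mn.
have rho2 : rho ^+ 2 = mn by rewrite sqr_sqrtr.
have rhor : 0 <= rho <= r.
  rewrite sqrtr_ge0/= -[leRHS](ger0_norm (ltW r0)) -sqrtr_sqr.
  by rewrite /rho ler_wsqrtr// ge_min lexx.
pose K := 4 + ln q.
have K0 : 0 < K by rewrite ltr_wpDr// ln_ge0.
pose M : R := (p - j)%:R / j.+1%:R.
have mM : m <= M * expR (- K).
  have -> : expR (- K) = expR (- 4) / q by rewrite opprD expRD [expR (- ln q)]expRN lnK.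
  have -> : m = q / 2 * (expR (- 4) / q) by rewrite /m; field; rewrite lt0r_neq0.
  rewrite ler_pM2r ?divr_gt0 ?expR_gt0//.
  rewrite /q /M mulrAC ler_pM2r ?invr_gt0// ler_pdivrMr// mulrC.
  by rewrite -natrM ler_nat.
(* The numerator is at most (3 + ln (p / k)) / 2, and [K / 2] is (4 + ln q) / 2 with ln q >= ln (p /
   k). *)
have info : (n%:R * (rho ^+ 2 / (2 * sigma ^+ 2)) + 1) / K <= 2^-1.
  rewrite ler_pdivrMr//.
  have : rho ^+ 2 <= sigma ^+ 2 * ((1 + ln (p%:R / k%:R)) / n%:R).
    by rewrite rho2 ge_min lexx orbT.
  have s2 : 0 < sigma ^+ 2 by rewrite exprn_gt0.
  rewrite mulrA ler_pdivlMr// mulrC => h.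
  have : n%:R * (rho ^+ 2 / (2 * sigma ^+ 2)) <= (1 + ln (p%:R / k%:R)) / 2.
    rewrite mulrA ler_pdivrMr ?mulr_gt0//; lra.
  rewrite /K; lra.
apply: le_ereal_inf_tmp => _ [est _ <-].
set s := ereal_sup _.
have risk_le (A : {set 'I_p}) : (#|A| <= k)%N -> (risk X Q obs est (set_tuple rho A) <= s)%E.
  move=> Ak; apply: ereal_sup_ubound; exists (set_tuple rho A) => //.
  exact: set_tuple_sparse_box.
have sq0 (A : {set 'I_p}) c i : (0 <= \int[Q (set_tuple rho A)]_w
    ((tnth (est (sample obs w)) i - c) ^+ 2)%:E)%E.
  by apply: integral_ge0 => w _; rewrite lee_fin sqr_ge0.
(* The null vector belongs to the class, so [s] dominates a nonnegative risk. *)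
have s0 : (0 <= s)%E.
  have h0 : (#|@finset.set0 'I_p| <= k)%N by rewrite cards0.
  by apply: (le_trans _ (risk_le _ h0)); rewrite riskE// sume_ge0.
pose F (A : {set 'I_p}) i := (\int[Q (set_tuple rho A)]_w
  (tnth (est (sample obs w)) i ^+ 2)%:E)%E.
pose H (A : {set 'I_p}) i := (\int[Q (set_tuple rho A)]_w
  ((tnth (est (sample obs w)) i - rho) ^+ 2)%:E)%E.
(* Dropping the coordinates outside [D] only lowers the risk. [D] will be the complement of the
   support for [F], where the target is 0, and the support itself for [H], where it is [rho]. *)
have risk_sum (A : {set 'I_p}) (D : pred 'I_p) G : (#|A| <= k)%N ->
    (forall i, D i -> G i = \int[Q (set_tuple rho A)]_w
      ((tnth (est (sample obs w)) i - tnth (set_tuple rho A) i) ^+ 2)%:E)%E ->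
    (\sum_(i | D i) G i <= s)%E.
  move=> Ak GE; apply: le_trans (risk_le _ Ak); rewrite riskE//.
  rewrite (eq_bigr _ GE) [leRHS](bigID D)/=.
  by rewrite leeDl// sume_ge0.
have main := @sparse_average R p j F H (m / (1 + m) * rho ^+ 2 / 2) s jp s0.
apply: le_trans (main _ _ _ _) => [|A i|A jA|B jB|A i iA].
- rewrite lee_fin rho2.
  have : k%:R <= 2 * j.+1%:R :> R by rewrite -natrM ler_nat.
  have c0 : 0 <= m / (1 + m) * mn by rewrite mulr_ge0// divr_ge0 ?ltW.
  nra.
- by apply: integral_ge0 => w _; rewrite lee_fin sqr_ge0.
- apply: (@risk_sum A) => [|i iA]; first by rewrite jA ltnW.
  by apply: eq_integral => w _; rewrite tnth_mktuple (negbTE iA) subr0.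
- apply: (@risk_sum B) => [|i iB]; first by rewrite jB.
  by apply: eq_integral => w _; rewrite tnth_mktuple iB.
have mt : measurable_fun setT (fun z => tnth (est z) i).
  exact: (measurableT_comp (measurable_tnth i)).
have hx x := dot_set_tupleU1 rho x iA.
apply: (le_trans _ (two_point_risk iid (lt0r_neq0 sigma0) law indep (EX i)
  (VX i) hx K0 m0 mM mt)).
rewrite lee_fin; apply: ler_wpM2l; last by lra.
by rewrite mulr_ge0 ?sqr_ge0// divr_ge0 ?ltW.
Qed.
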